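(* Let $F$ be an algebraically closed field of characteristic $0$, let $n$ be a positive integer, let $\mathcal{A}=M_n(F)$, and let $f\in F\langle\mathcal{X}\rangle$ be a polynomial which is neither an identity nor a central polynomial of $\mathcal{A}$. Suppose that either (a) $n$ is prime, or (b) $f$ is multilinear. Then $f(\mathcal{A})-f(\mathcal{A})$ contains all trace zero matrices in $\mathcal{A}$.
   Context: $F\langle\mathcal{X}\rangle$ is the free unital associative algebra over $F$ generated by $\mathcal{X}=\{X_1,X_2,\dots\}$; its elements are called (noncommutative) polynomials. For $f=f(X_1,\dots,X_m)$ and an $F$-algebra $\mathcal{A}$, the image of $f$ is $f(\mathcal{A})=\{f(a_1,\dots,a_m)\mid a_1,\dots,a_m\in\mathcal{A}\}$. The polynomial $f$ is an identity of $\mathcal{A}$ if $f(\mathcal{A})=\{0\}$; it is a central polynomial for $\mathcal{A}$ if $f(\mathcal{A})$ is contained in the center of $\mathcal{A}$ but $f$ is not an identity of $\mathcal{A}$. A polynomial $f(X_1,\dots,X_m)$ is multilinear if it is an $F$-linear combination of the monomials $X_{\sigma(1)}\cdots X_{\sigma(m)}$ with $\sigma$ a permutation of $\{1,\dots,m\}$. Moreover, $f(\mathcal{A})-f(\mathcal{A})=\{s-t\mid s,t\in f(\mathcal{A})\}$. *)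

(* Defs.v *)
From HB Require Import structures.
From mathcomp Require Import all_boot all_order all_fingroup all_algebra.
From mathcomp Require Import finmap.
From mathcomp.multinomials Require Import monalg.

Set Implicit Arguments.
Unset Strict Implicit.
Unset Printing Implicit Defensive.

Import GRing.Theory.
Local Open Scope ring_scope.

(* The free unital associative algebra F<X_1, X_2, ...> is the monoid algebra
   of the free monoid on countably many letters.  Variables are numbered from
   0, so that [ncvar F i] is X_(i+1). *)
Notation ncpoly F := {malg F[{fmonom nat}]}.

Definition ncvar (F : fieldType) (i : nat) : ncpoly F := << fmu i >>.

(* f(a_0, a_1, ...).  A polynomial involves finitely many variables; the
   assignment a is total, and its values at the other variables play no role,
   so no bound on the number of variables of f has to be carried around. *)
Definition nceval (F : fieldType) (A : algType F) (a : nat -> A)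
    (f : ncpoly F) : A :=
  \sum_(w <- msupp f) f@_w *: \prod_(i <- (w : seq nat)) a i.

Definition ncimage (F : fieldType) (f : ncpoly F) (A : algType F) (b : A) :
    Prop :=
  exists a : nat -> A, b = nceval a f.

Definition poly_identity (F : fieldType) (f : ncpoly F) (A : algType F) :
    Prop :=
  forall b : A, ncimage f b <-> b = 0.

Definition central (A : pzRingType) (b : A) : Prop :=
  forall c : A, GRing.comm b c.

Definition central_polynomial (F : fieldType) (f : ncpoly F)
    (A : algType F) : Prop :=
  (forall b : A, ncimage f b -> central b) /\ ~ poly_identity f A.

Definition multilinear (F : fieldType) (f : ncpoly F) : Prop :=
  exists (m : nat) (c : 'S_m -> F),
    f = \sum_(s : 'S_m) c s *: \prod_(i < m) ncvar F (s i).

Definition ncimage_diff (F : fieldType) (f : ncpoly F) (A : algType F)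
    (b : A) : Prop :=
  exists s t : A, [/\ ncimage f s, ncimage f t & b = s - t].

(* Main.v *)
(* It suffices to find in f(M_n(F)) a matrix D with n distinct eigenvalues d_i.
   Indeed the image is stable under conjugation, T is similar to a matrix with
   zero diagonal, hence to a difference L - U where L is lower triangular, U is
   upper triangular and both have diagonal (d_i); both are similar to D.

   To find D, let X = diag(z^i) and Y be the clock and shift matrices, z a
   primitive n-th root of unity.  A matrix W that is invertible and satisfies
   Z W = z' W Z for an invertible Z and a primitive n-th root z' has n distinct
   eigenvalues.

   n prime: write a_k = sum c_ij X^i Y^j with f(a) not scalar, and deform it to
   sum c_ij s^i t^j X^i Y^j.  Then f becomes a polynomial in s, t whose
   coefficient at s^i t^j is a multiple of X^i Y^j.  Discard the scalar terms
   (n | i and n | j); the others are not all zero.  Along s = u, t = u^K the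
   dominating term is a multiple of one noncentral X^i Y^j, which has n distinct
   eigenvalues because n is prime, and having distinct eigenvalues is
   a Zariski open condition.

   f multilinear: after a conjugation, f(a) has a nonzero entry (0,1).  Splitting
   the a_k along the grading of M_n(F) by j - i mod n, some homogeneous b_k
   have f(b) homogeneous of degree 1 and with nonzero entry (0,1).  Rotating the
   indices moves the nonzero entry to any (i,i+1), so that for generic b_k of
   these degrees all the entries (i,i+1) are nonzero.  Then f(b) is invertible
   and f(b) X = z X f(b). *)
Require Import Defs.
From Stdlib Require Import Classical_Prop.
From mathcomp Require Import all_boot all_order all_fingroup all_algebra.
From mathcomp Require Import cyclic separable cyclotomic.
From mathcomp Require Import ring.
From mathcomp Require Import finmap.
From mathcomp.multinomials Require Import monalg.

Set Implicit Arguments.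
Unset Strict Implicit.
Unset Printing Implicit Defensive.

Import GRing.Theory.
Local Open Scope ring_scope.

(** * Diagonalisation and similarity of matrices with distinct eigenvalues *)

Definition simple_spectrum (F : fieldType) n (M : 'M[F]_n) : Prop :=
  exists d : 'I_n -> F, injective d /\ forall i, eigenvalue M (d i).

(** Eigenspaces for distinct eigenvalues are in direct sum, so one eigenvector from each gives the
    rows of an invertible [V]. *)
Lemma diagonalize_eigenvalues (F : fieldType) n (M : 'M[F]_n) (d : 'I_n -> F) :
  injective d -> (forall i, eigenvalue M (d i)) ->
  exists2 V, V \in unitmx & V *m M = diag_mx (\row_i d i) *m V.
Proof.
move=> d_inj Md; pose v i := nz_row (eigenspace M (d i)).
have v_sub i : (v i <= eigenspace M (d i))%MS by exact: nz_row_sub.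
have v_nz i : v i != 0 by rewrite nz_row_eq0; exact: Md.
pose V := \matrix_i v i; exists V; last first.
  apply/row_matrixP => i; rewrite !row_mul rowK (eigenspaceP (v_sub i)).
  by rewrite row_diag_mx mxE -scalemxAl -rowE rowK.
rewrite -row_free_unit; apply: inj_row_free => u uV0.
have: mxdirect (\sum_i eigenspace M (d i)).
  by apply: mxdirect_sum_eigenspace => i j _ _; exact: d_inj.
move=> /mxdirect_sumsP dirE; apply/rowP => i; rewrite mxE; apply/eqP.
have uvi0 : u 0 i *: v i = 0.
  apply/eqP; rewrite -submx0 -(dirE i isT) sub_capmx scalemx_sub //=.
  have := uV0; rewrite mulmx_sum_row (bigD1 i) //= rowK => /eqP.
  rewrite addr_eq0 => /eqP ->; rewrite eqmx_opp summx_sub // => j ji.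
  by rewrite rowK (sumsmx_sup j) // scalemx_sub.
by move/eqP: uvi0; rewrite scaler_eq0 (negPf (v_nz i)) orbF.
Qed.

Lemma similar_of_eigenvalues (F : fieldType) n (A B : 'M[F]_n)
    (d : 'I_n -> F) :
    injective d -> (forall i, eigenvalue A (d i)) ->
    (forall i, eigenvalue B (d i)) ->
  exists2 g, g \in unitmx & B = g *m A *m invmx g.
Proof.
move=> d_inj Ad Bd.
have [V Vu VA] := diagonalize_eigenvalues d_inj Ad.
have [W Wu WB] := diagonalize_eigenvalues d_inj Bd.
exists (invmx W *m V); first by rewrite unitmx_mul unitmx_inv Wu.
apply: (canRL (mulmxK _)); first by rewrite unitmx_mul unitmx_inv Wu.
rewrite -(mulmxA _ V A) VA -[in LHS](mulKmx Wu B) WB.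
by rewrite !mulmxA mulmxK.
Qed.

Lemma eigenvalue_trig (F : fieldType) n (A : 'M[F]_n) i :
  is_trig_mx A -> eigenvalue A (A i i).
Proof.
move=> At; rewrite eigenvalue_root_char char_poly_trig //.
by rewrite (bigD1 i) //= rootM root_XsubC eqxx.
Qed.

Lemma eigenvalue_tr (F : fieldType) n (A : 'M[F]_n) a :
  eigenvalue A^T a = eigenvalue A a.
Proof.
rewrite !eigenvalue_root_char /char_poly -[in RHS]det_tr; congr root.
by congr (\det _); apply/matrixP => i j; rewrite !mxE eq_sym.
Qed.

(** * Trace zero matrices: conjugation to zero diagonal and splitting into triangular matrices *)

(** If every basis vector is an eigenvector, then [M] is diagonal; if moreover its entries at 0 and
    i differ, the sum of these two basis vectors is not an eigenvector. *)
Lemma nonscalar_row (F : fieldType) n (M : 'M[F]_n.+1) :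
  ~~ is_scalar_mx M -> exists v : 'rV_n.+1, ~~ (v *m M <= v)%MS.
Proof.
move=> Mns; have [/existsP[v vP]|] :=
  boolP [exists i : 'I_n.+1,
    ~~ ((delta_mx 0 i : 'rV_n.+1) *m M <= (delta_mx 0 i : 'rV_n.+1))%MS].
  by eexists; exact: vP.
rewrite negb_exists => /forallP eig.
have Md i j : i != j -> M i j = 0.
  move=> ij; have := eig i; rewrite negbK => /sub_rVP[a].
  rewrite -rowE => /rowP/(_ j); rewrite !mxE eqxx /= => ->.
  by rewrite eq_sym (negPf ij) mulr0.
have [/existsP[i Mi]|] := boolP [exists i, M i i != M 0 0].
  exists (delta_mx 0 0 + delta_mx 0 i).
  have i0 : i != 0 by apply: contra Mi => /eqP ->.
  apply: contra Mi => /sub_rVP[a].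
  rewrite mulmxDl -!rowE => /rowP E.
  have := E 0; have := E i; rewrite !mxE !eqxx /= ?(eq_sym 0 i) !(negPf i0) /=.
  by rewrite (Md 0 i) 1?eq_sym // (Md i 0) // !add0r !addr0 => -> ->.
rewrite negb_exists => /forallP Mc; case/negP: Mns.
apply/is_scalar_mxP; exists (M 0 0); apply/matrixP => i j; rewrite !mxE.
case: eqP => [<-|/eqP/Md -> //]; apply/eqP; have := Mc i; by rewrite negbK.
Qed.

(** In a basis that starts with [v] and [v *m M], where [v] is not an eigenvector, the matrix sends
    the first basis vector to the second. *)
Lemma nonscalar_conj_row0 (F : fieldType) n (M : 'M[F]_(2 + n)) :
  ~~ is_scalar_mx M ->
  exists2 g, g \in unitmx & row 0 (g *m M *m invmx g) = delta_mx 0 1.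
Proof.
move=> /nonscalar_row[v vM].
pose A : 'M_(2, 2 + n) := col_mx v (v *m M).
have rA : \rank A = 2%N.
  apply/eqP; rewrite -/(row_free A); apply: (inj_row_free (m := (1 + 1)%N)) => u.
  rewrite -[u]hsubmxK mul_row_col; set a := lsubmx u; set b := rsubmx u.
  rewrite (mx11_scalar a) (mx11_scalar b) !mul_scalar_mx => /eqP.
  rewrite addrC addr_eq0 => /eqP bE.
  have b0 : b 0 0 = 0.
    apply/eqP; apply: contraNT vM => b0; apply/sub_rVP.
    exists ((b 0 0)^-1 * - a 0 0).
    by rewrite -scalerA scaleNr -bE scalerA mulVf // scale1r.
  have v0 : v != 0 by apply: contraNneq vM => ->; rewrite mul0mx submx_refl.
  move/eqP: bE; rewrite b0 scale0r eq_sym oppr_eq0 scaler_eq0 (negPf v0) orbF.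
  by move=> /eqP a0; rewrite a0 !raddf0 row_mx0.
(* The rank factorisation completes the two independent rows of [A] to an invertible matrix:
   [col_ebase A] times the two upper rows of [row_ebase A] is [A]. *)
pose g : 'M_(2 + n) := block_mx (col_ebase A) 0 0 1%:M *m row_ebase A.
have gu : g \in unitmx.
  rewrite unitmx_mul row_ebase_unit andbT unitmxE det_ublock det1.
  by rewrite mulr1 -unitmxE col_ebase_unit.
have gE : usubmx g = A.
  rewrite -[RHS]mulmx_ebase rA pid_mx_row mul_mx_row mulmx1 mulmx0.
  by rewrite /g block_mxEv mul_col_mx col_mxKu.
exists g => //.
clearbody g; have g0 : row 0 g = v.
  have -> : row 0 g = row 0 (usubmx g).
    by apply/rowP => j; rewrite !mxE; congr (g _ _); apply/val_inj.
  rewrite gE; apply/rowP => j; rewrite !mxE.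
  by case: splitP => // k _; rewrite ord1.
have g1 : row 1 g = v *m M.
  have -> : row 1 g = row 1 (usubmx g).
    by apply/rowP => j; rewrite !mxE; congr (g _ _); apply/val_inj.
  rewrite gE; apply/rowP => j; rewrite mxE [LHS]mxE.
  by case: splitP => [[[]] //|k _]; rewrite ord1.
by rewrite !row_mul g0 -g1 [row 1 g]rowE mulmxK.
Qed.

Lemma natr_neq0 (F : fieldType) (charF0 : [pchar F] =i pred0) n :
  n.+1%:R != 0 :> F.
Proof. by rewrite (proj1 (pcharf0P F) charF0). Qed.

(** Induction on the size. A scalar matrix of trace zero vanishes in characteristic 0; any other has
    a conjugate with first row [delta_mx 0 1], hence with corner entry 0, and the lower right block
    of that conjugate again has trace zero. *)
Lemma trace0_conj_zero_diag (F : fieldType) (charF0 : [pchar F] =i pred0) n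
    (T : 'M[F]_n) :
  \tr T = 0 ->
  exists2 g, g \in unitmx & forall i, (g *m T *m invmx g) i i = 0.
Proof.
elim: n T => [|n IHn] T trT; first by exists 1%:M; [exact: unitmx1 | case].
have [/is_scalar_mxP[a Ta]|Tns] := boolP (is_scalar_mx T).
  exists 1%:M => [|i]; first exact: unitmx1.
  move/eqP: trT; rewrite Ta mxtrace_scalar -mulr_natr mulf_eq0.
  rewrite (negPf (natr_neq0 charF0 n)) orbF => /eqP ->.
  by rewrite raddf0 mulmx0 mul0mx mxE.
case: n T IHn trT Tns => [|n] T IHn trT Tns.
  by case/negP: Tns; rewrite [T]mx11_scalar scalar_mx_is_scalar.
have [g gu g0] := nonscalar_conj_row0 Tns.
set T1 := g *m T *m invmx g in g0.
have T1E : T1 = @block_mx F 1 n.+1 1 n.+1 0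
    (@ursubmx F 1 n.+1 1 n.+1 T1) (@dlsubmx F 1 n.+1 1 n.+1 T1)
    (@drsubmx F 1 n.+1 1 n.+1 T1).
  suff ul0 : @ulsubmx F 1 n.+1 1 n.+1 T1 = 0.
    by rewrite -ul0 (@submxK F 1 n.+1 1 n.+1).
  have T00 : row 0 T1 0 0 = 0 by rewrite g0 mxE.
  apply/matrixP => i j; rewrite !ord1 [RHS]mxE -[RHS]T00 [RHS]mxE.
  by rewrite [LHS]mxE [LHS]mxE; congr (T1 _ _); exact/val_inj.
have [h hu hT] : exists2 h, h \in unitmx &
    forall i, (h *m @drsubmx F 1 n.+1 1 n.+1 T1 *m invmx h) i i = 0.
  apply: IHn; have: \tr T1 = 0 by rewrite /T1 mxtrace_mulC mulKmx.
  rewrite {1}T1E => T1tr; have := etrans (esym (@mxtrace_block F 1 n.+1 _ _ _ _)) T1tr.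
  by rewrite raddf0 add0r.
pose h1 : 'M_(1 + n.+1) := block_mx 1%:M 0 0 h.
have h1V : h1 *m block_mx 1%:M 0 0 (invmx h) = 1%:M.
  rewrite mulmx_block !(mul0mx, mulmx0, mul1mx, mulmx1, addr0, add0r) mulmxV //.
  by rewrite -scalar_mx_block.
have [h1u _] := mulmx1_unit h1V.
have h1VE : invmx h1 = block_mx 1%:M 0 0 (invmx h).
  by rewrite -[RHS](mulKmx h1u) h1V mulmx1.
have hgu : h1 *m g \in unitmx by rewrite unitmx_mul h1u.
exists (h1 *m g) => // i.
have -> : h1 *m g *m T *m invmx (h1 *m g) = h1 *m T1 *m invmx h1.
  apply: (canLR (mulmxK hgu)); rewrite /T1 !mulmxA.
  by rewrite (mulmxKV h1u) (mulmxKV gu).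
rewrite h1VE T1E !(@mulmx_block F 1 n.+1 1 n.+1 1 n.+1).
rewrite !(mul0mx, mulmx0, mul1mx, mulmx1, addr0, add0r).
case: (@split_ordP 1 n.+1 i) => k ->.
  by apply: etrans (@block_mxEul F 1 n.+1 1 n.+1 _ _ _ _ k k) _; rewrite mxE.
exact: etrans (@block_mxEdr F 1 n.+1 1 n.+1 _ _ _ _ k k) (hT k).
Qed.

(** [P] abstracts the image of the polynomial: what matters is stability under conjugation and one
    element with distinct eigenvalues. *)
Lemma trace0_sub_of_simple_spectrum (F : fieldType)
    (charF0 : [pchar F] =i pred0) n (P : 'M[F]_n -> Prop) (D T : 'M[F]_n) :
    (forall g A, g \in unitmx -> P A -> P (g *m A *m invmx g)) ->
    simple_spectrum D -> P D -> \tr T = 0 ->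
  exists A B, [/\ P A, P B & T = A - B].
Proof.
move=> Pconj [d [d_inj Dd]] PD /(trace0_conj_zero_diag charF0)[g gu gT].
have Psim M : (forall i, eigenvalue M (d i)) -> P M.
  move=> Md; have [h hu ->] := similar_of_eigenvalues d_inj Dd Md.
  exact: Pconj.
set T0 := g *m T *m invmx g in gT.
have TE : T = invmx g *m T0 *m g.
  by rewrite /T0 !mulmxA mulVmx // mul1mx mulmxKV.
(* [L] carries the part of [T0] below the diagonal, [U] minus the part above it. The diagonals [d]
   cancel in [L - U], and both matrices have the eigenvalues [d i], so they are conjugate to [D]. *)
clearbody T0; pose L : 'M_n := \matrix_(i, j) (d i *+ (i == j) + T0 i j *+ (j < i)).
pose U : 'M_n := \matrix_(i, j) (d i *+ (i == j) - T0 i j *+ (i < j)).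
have PL : P L.
  apply: Psim => i; have := @eigenvalue_trig F n L i.
  rewrite mxE eqxx ltnn addr0; apply; apply/is_trig_mxP => j k jk.
  by rewrite mxE -val_eqE (ltn_eqF jk) ltnNge ltnW // addr0.
have PU : P U.
  apply: Psim => i; rewrite -eigenvalue_tr; have := @eigenvalue_trig F n U^T i.
  rewrite !mxE eqxx ltnn subr0; apply; apply/is_trig_mxP => j k jk.
  by rewrite !mxE -val_eqE (gtn_eqF jk) ltnNge ltnW // subr0.
have gVu : invmx g \in unitmx by rewrite unitmx_inv.
exists (invmx g *m L *m g), (invmx g *m U *m g); split.
- by rewrite -[X in _ *m X]invmxK; apply: Pconj.
- by rewrite -[X in _ *m X]invmxK; apply: Pconj.
rewrite -mulmxBl -mulmxBr.
have -> : L - U = T0.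
  apply/matrixP => i j; rewrite !mxE.
  rewrite opprB addrC addrA subrK.
  have [ij|ji|/val_inj <-] := ltngtP i j; rewrite ?mulr0n ?mulr1n ?add0r ?addr0 ?gT //.
exact: TE.
Qed.

(** * Criteria for distinct eigenvalues, and genericity *)

Lemma simple_spectrum_shift_scale (F : fieldType) n (M : 'M[F]_n) a c :
  c != 0 -> simple_spectrum M -> simple_spectrum (a%:M + c *: M).
Proof.
move=> c0 [d [d_inj Md]]; exists (fun i => a + c * d i); split.
  by move=> i j /addrI/(mulfI c0)/d_inj.
move=> i; have /eigenvalueP[v vM v0] := Md i; apply/eigenvalueP; exists v => //.
by rewrite mulmxDr mul_mx_scalar -scalemxAr vM scalerA -scalerDl.
Qed.

(* Right multiplication by Z turns an eigenvector of W for l into one for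
   z * l, so the eigenvalues of W are the n distinct numbers z^i l. *)
Lemma simple_spectrum_of_commute_root (F : closedFieldType) n
    (W Z : 'M[F]_n.+1) z :
    n.+1.-primitive_root z -> W \in unitmx -> Z \in unitmx ->
    Z *m W = z *: (W *m Z) ->
  simple_spectrum W.
Proof.
move=> zP Wu Zu ZW.
have [l] : exists l, root (char_poly W) l.
  by apply/closed_rootP; rewrite size_char_poly.
rewrite -eigenvalue_root_char => Wl.
have l0 : l != 0.
  apply/eqP => l0; have /eigenvalueP[v vW /negP[]] := Wl; apply/eqP.
  by rewrite -(mulmxK Wu v) vW l0 scale0r mul0mx.
have Wzl i : eigenvalue W (z ^+ i * l).
  elim: i => [|i /eigenvalueP[v vW v0]]; first by rewrite mul1r.
  apply/eigenvalueP; exists (v *m Z); last first.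
    by apply: contraNneq v0 => vZ; rewrite -(mulmxK Zu v) vZ mul0mx.
  rewrite -mulmxA ZW -scalemxAr mulmxA vW -scalemxAl scalerA.
  by rewrite exprS mulrA.
exists (fun i : 'I_n.+1 => z ^+ i * l); split=> // i j /(mulIf l0)/eqP.
by rewrite (eq_prim_root_expr zP) !modn_small // => /eqP/val_inj.
Qed.

(** Restates distinctness of the eigenvalues as a condition on the characteristic polynomial that a
    resultant can test. *)
Lemma simple_spectrumP (F : closedFieldType) n (M : 'M[F]_n) :
  simple_spectrum M <-> separable_poly (char_poly M).
Proof.
split=> [[d [d_inj Md]]|].
  have sd : size (char_poly M) = (size [seq d i | i <- enum 'I_n]).+1.
    by rewrite size_char_poly size_map size_enum_ord.
  have ud : uniq [seq d i | i <- enum 'I_n] by rewrite map_inj_uniq ?enum_uniq.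
  have rd : all (root (char_poly M)) [seq d i | i <- enum 'I_n].
    by apply/allP => _ /mapP[i _ ->]; rewrite -eigenvalue_root_char; exact: Md.
  rewrite (all_roots_prod_XsubC sd rd) ?uniq_rootsE //.
  by rewrite (monicP (char_poly_monic M)) scale1r separable_prod_XsubC.
have [r rE] := closed_field_poly_normal (char_poly M).
have := size_char_poly M; rewrite rE (monicP (char_poly_monic M)) scale1r.
rewrite size_prod_XsubC separable_prod_XsubC => -[sr] ur.
exists (fun i : 'I_n => r`_i); split=> [i j /eqP|i].
  by rewrite nth_uniq ?sr // => /eqP/val_inj.
rewrite eigenvalue_root_char rE (monicP (char_poly_monic M)) scale1r.
by rewrite root_prod_XsubC mem_nth ?sr.
Qed.

(** The resultant of a polynomial and its derivative commutes with specialisation when neither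
    leading coefficient vanishes; this computes the second one. *)
Lemma lead_coef_deriv_monic (R : nzRingType) (p : {poly R}) n :
  p \is monic -> size p = n.+2 -> n.+1%:R != 0 :> R ->
  lead_coef p^`() = n.+1%:R.
Proof.
move=> pm sp n0.
have pn : p^`()`_n = n.+1%:R.
  by rewrite coef_deriv; move/monicP: pm; rewrite lead_coefE sp => ->.
have sd : size p^`() = n.+1.
  apply/eqP; rewrite eqn_leq; apply/andP; split.
    by rewrite -ltnS -sp lt_size_deriv // -size_poly_gt0 sp.
  rewrite ltnNge; apply/negP => /leq_sizeP/(_ n (leqnn n)) pn0.
  by rewrite -pn pn0 eqxx in n0.
by rewrite lead_coefE sd.
Qed.

(* The witness is the discriminant of the characteristic polynomial. *)
Lemma simple_spectrum_generic (F : closedFieldType)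
    (charF0 : [pchar F] =i pred0) n (N : 'M[{poly F}]_n.+1) a :
    simple_spectrum (map_mx (horner_eval a) N) ->
  exists2 p : {poly F}, p != 0 &
    forall x, ~~ root p x -> simple_spectrum (map_mx (horner_eval x) N).
Proof.
move=> Na; pose p := resultant (char_poly N) (char_poly N)^`().
have pE x : (root p x = ~~ separable_poly (char_poly (map_mx (horner_eval x) N))).
  have n0 := natr_neq0 charF0 n.
  have l1 : horner_eval x (lead_coef (char_poly N)) != 0.
    by rewrite (monicP (char_poly_monic N)) rmorph1 oner_neq0.
  have l2 : horner_eval x (lead_coef (char_poly N)^`()) != 0.
    rewrite (@lead_coef_deriv_monic _ _ n) ?char_poly_monic ?size_char_poly //.
      by rewrite rmorph_nat.
    by rewrite -polyC_natr polyC_eq0.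
  rewrite rootE -[p.[x]]/(horner_eval x p) map_resultant // resultant_eq0.
  rewrite -deriv_map map_char_poly unlock /coprimep.
  set q := char_poly _; have : gcdp q q^`() != 0.
    by rewrite gcdp_eq0 negb_and monic_neq0 // char_poly_monic.
  by rewrite -size_poly_gt0; case: size => [|[]].
exists p => [|x]; last by rewrite pE negbK => /simple_spectrumP.
apply: contraTneq (iffLR (simple_spectrumP _) Na) => p0.
by rewrite -pE p0 root0.
Qed.

(** Dividing the sum by u^E and setting w = 1/u gives a polynomial in w with value [P E] at w = 0;
    distinctness of the eigenvalues there spreads to generic w. *)
Lemma simple_spectrum_dominant (F : closedFieldType)
    (charF0 : [pchar F] =i pred0) n (P : nat -> 'M[F]_n.+1) E :
    simple_spectrum (P E) ->
  exists2 u, u != 0 & simple_spectrum (\sum_(e < E.+1) u ^+ e *: P e).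
Proof.
move=> PE; pose N := \sum_(e < E.+1) 'X^(E - e) *: map_mx polyC (P e).
have Nx x : map_mx (horner_eval x) N = \sum_(e < E.+1) x ^+ (E - e) *: P e.
  rewrite [LHS]raddf_sum; apply: eq_bigr => e _; apply/matrixP => i j.
  by rewrite !mxE /= /horner_eval hornerM hornerXn hornerC.
have [|p p0 pP] := @simple_spectrum_generic F charF0 n N 0.
  rewrite Nx big_ord_recr /= subnn scale1r big1 ?add0r // => e _.
  by rewrite expr0n subn_eq0 leqNgt ltn_ord scale0r.
(* The factor ['X] keeps w away from 0, so that u = 1/w exists. *)
have /closed_nonrootP[w] : p * 'X != 0 by rewrite mulf_neq0 ?polyX_eq0.
rewrite rootM rootX negb_or => /andP[/pP Nw w0].
exists w^-1; first by rewrite invr_eq0.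
have wE0 : w^-1 ^+ E != 0 by rewrite expf_neq0 ?invr_eq0.
have -> : \sum_(e < E.+1) w^-1 ^+ e *: P e
    = 0%:M + w^-1 ^+ E *: map_mx (horner_eval w) N.
  rewrite raddf0 add0r Nx scaler_sumr; apply: eq_bigr => e _; rewrite scalerA.
  congr (_ *: _); have eE : (e <= E)%N by rewrite -ltnS.
  rewrite -{2}(subnK eE) exprD mulrAC -exprMn.
  by rewrite mulVf // expr1n mul1r.
exact: simple_spectrum_shift_scale.
Qed.

(** * Conjugation of values of polynomials, and primitive roots of unity *)

Lemma nceval_conj (F : fieldType) n (f : ncpoly F) (a : nat -> 'M[F]_n.+1) g :
  g \in unitmx ->
  nceval (fun k => g *m a k *m invmx g) f = g *m nceval a f *m invmx g.
Proof.
move=> gu; rewrite /nceval mulmx_sumr mulmx_suml; apply: eq_bigr => w _.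
rewrite -scalemxAr -scalemxAl; congr (_ *: _).
elim: (w : seq nat) => [|k s IHs]; first by rewrite !big_nil mulmx1 mulmxV.
rewrite !big_cons IHs -[LHS]/(_ *m _) -[in RHS]/(a k *m _).
by rewrite !mulmxA (mulmxKV gu).
Qed.

Lemma ncimage_conj (F : fieldType) n (f : ncpoly F) (A : 'M[F]_n.+1) g :
  g \in unitmx -> ncimage f A -> ncimage f (g *m A *m invmx g).
Proof.
by move=> gu [a ->]; exists (fun k => g *m a k *m invmx g); rewrite nceval_conj.
Qed.

(** In characteristic 0, X^(n+1) - 1 is separable; its n+1 distinct roots form a group of roots of
    unity, which contains a primitive one. *)
Lemma primitive_root_exists (F : closedFieldType)
    (charF0 : [pchar F] =i pred0) n :
  exists z : F, n.+1.-primitive_root z.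
Proof.
have n0 := natr_neq0 charF0 n.
have [r rE] := closed_field_poly_normal ('X^(n.+1) - 1 : {poly F}).
have := separable_Xn_sub_1 n0.
have sr : size ('X^(n.+1) - 1 : {poly F}) = n.+2 by rewrite size_XnsubC.
rewrite (monicP (monicXnsubC _ _)) // scale1r in rE.
rewrite rE separable_prod_XsubC => ur; move: sr; rewrite rE size_prod_XsubC => -[sr].
have /hasP[z _ zP] : has n.+1.-primitive_root r.
  apply: has_prim_root => //; last by rewrite sr.
  by apply/allP => x xr; rewrite -[_ x]/(root _ x) rE root_prod_XsubC.
by exists z.
Qed.

(** * Clock and shift matrices, and the two-parameter deformation *)

Section QuantumTorus.

Variables (F : fieldType) (n : nat) (z : F).
Hypothesis zP : n.+2.-primitive_root z.
Local Notation N := n.+2.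

(** The sum on the left is taken modulo [N], which is harmless because [z ^+ N = 1]. *)
Lemma prim_expr_ordD (i j : 'I_N) : z ^+ (i + j)%R = z ^+ i * z ^+ j.
Proof. by rewrite -exprD -(prim_expr_mod zP (i + j)%N). Qed.

Definition clock_mx : 'M[F]_N := diag_mx (\row_i z ^+ i).
Definition shift_mx : 'M[F]_N := \matrix_(i, j) (j == i + 1)%:R.

Local Notation X := clock_mx.
Local Notation Y := shift_mx.

Lemma clock_mxX k : X ^+ k = diag_mx (\row_i z ^+ (i * k)).
Proof.
elim: k => [|k IHk].
  by apply/matrixP => i j; rewrite !mxE muln0.
rewrite exprS IHk; apply/matrixP => i j.
by rewrite -[_ * _]/(_ *m _) mul_diag_mx !mxE mulnS exprD mulrnAr.
Qed.

Lemma shift_mxX k i j : (Y ^+ k) i j = (j == i + k%:R)%:R.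
Proof.
elim: k i => [|k IHk] i; first by rewrite !mxE addr0 eq_sym.
rewrite exprS -[_ * _]/(_ *m _) mxE (bigD1 (i + 1)) //= big1 => [|m mi].
  by rewrite mxE eqxx mul1r IHk addr0 -addrA -mulrS.
by rewrite mxE (negPf mi) mul0r.
Qed.

Lemma shift_clock : Y * X = z *: (X * Y).
Proof.
apply/matrixP => i j; rewrite -[Y * X]/(Y *m X) -[X * Y]/(X *m Y).
rewrite mul_mx_diag mul_diag_mx !mxE.
case: eqP => [->|_]; last by rewrite mul0r !mulr0.
by rewrite prim_expr_ordD mul1r mulr1 mulrC; congr (_ * _).
Qed.

Lemma shift_clockX i j : Y ^+ j * X ^+ i = z ^+ (j * i) *: (X ^+ i * Y ^+ j).
Proof.
elim: j => [|j IHj]; first by rewrite mul0n scale1r mul1r mulr1.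
have YX : Y * X ^+ i = z ^+ i *: (X ^+ i * Y).
  elim: i {IHj} => [|i IHi]; first by rewrite scale1r mul1r mulr1.
  rewrite (exprSr X) mulrA IHi -scalerAl -(mulrA _ Y) shift_clock -scalerAr.
  by rewrite scalerA mulrA -!exprSr.
rewrite exprS -mulrA IHj -scalerAr (mulrA Y) YX -scalerAl scalerA -exprD.
by rewrite addnC -mulSn mulrA.
Qed.

Lemma clock_shift_mul i j k l :
  (X ^+ i * Y ^+ j) * (X ^+ k * Y ^+ l)
  = z ^+ (j * k) *: (X ^+ (i + k) * Y ^+ (j + l)).
Proof.
rewrite -mulrA (mulrA (Y ^+ j)) shift_clockX -scalerAl -scalerAr.
by rewrite !exprD !mulrA.
Qed.

Lemma clock_unit : X \is a GRing.unit.
Proof.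
have XN : X ^+ N = 1.
  apply/matrixP => i j; rewrite clock_mxX !mxE mulnC exprM.
  by rewrite (prim_expr_order zP) expr1n.
by apply/unitrP; exists (X ^+ n.+1); rewrite -exprS -exprSr.
Qed.

Lemma shift_unit : Y \is a GRing.unit.
Proof.
have YN : Y ^+ N = 1.
  apply/matrixP => i j; rewrite shift_mxX mxE eq_sym.
  by have /= -> := pchar_Zp (isT : 1 < N)%N; rewrite addr0.
by apply/unitrP; exists (Y ^+ n.+1); rewrite -exprS -exprSr.
Qed.

(** A triple [(c, i, j)] encodes the term c s^i t^j X^i Y^j. The exponents are natural numbers, not
    classes modulo [N], and may repeat in the list. *)
Definition torus_poly (l : seq (F * nat * nat)) (s t : F) : 'M[F]_N :=
  \sum_(q <- l) (q.1.1 * s ^+ q.1.2 * t ^+ q.2) *: (X ^+ q.1.2 * Y ^+ q.2).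

Definition is_torus_poly (phi : F -> F -> 'M[F]_N) : Prop :=
  exists l, forall s t, phi s t = torus_poly l s t.

Lemma is_torus_poly_sum (I : Type) (r : seq I) (phi : I -> F -> F -> 'M[F]_N) :
  (forall i, is_torus_poly (phi i)) ->
  is_torus_poly (fun s t => \sum_(i <- r) phi i s t).
Proof.
move=> phiP; elim: r => [|i r [l lE]].
  by exists [::] => s t; rewrite /torus_poly !big_nil.
have [k kE] := phiP i; exists (k ++ l) => s t.
by rewrite /torus_poly big_cons big_cat /= kE lE.
Qed.

Lemma is_torus_polyZ c phi :
  is_torus_poly phi -> is_torus_poly (fun s t => c *: phi s t).
Proof.
move=> [l lE]; exists [seq (c * q.1.1, q.1.2, q.2) | q <- l] => s t.
rewrite lE /torus_poly scaler_sumr big_map; apply: eq_bigr => q _ /=.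
by rewrite scalerA !mulrA.
Qed.

Lemma is_torus_poly_monomial i j :
  is_torus_poly (fun s t => (s ^+ i * t ^+ j) *: (X ^+ i * Y ^+ j)).
Proof.
by exists [:: (1, i, j)] => s t; rewrite /torus_poly big_seq1 mul1r.
Qed.

(** Clock and shift monomials multiply, up to a power of z, by adding exponents, exactly as the
    monomials in s and t that go with them. *)
Lemma is_torus_polyM phi psi :
  is_torus_poly phi -> is_torus_poly psi ->
  is_torus_poly (fun s t => phi s t * psi s t).
Proof.
move=> [l lE] [k kE].
exists [seq (q.1.1 * r.1.1 * z ^+ (q.2 * r.1.2), (q.1.2 + r.1.2)%N, (q.2 + r.2)%N)
  | q <- l, r <- k] => s t.
rewrite lE kE /torus_poly big_distrlr big_allpairs_dep /=.
apply: eq_bigr => q _; apply: eq_bigr => r _.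
rewrite -scalerAl -scalerAr clock_shift_mul !scalerA; congr (_ *: _).
by rewrite !exprD; ring.
Qed.

Lemma is_torus_poly1 : is_torus_poly (fun _ _ => 1).
Proof.
have [l lE] := is_torus_poly_monomial 0 0; exists l => s t; rewrite -lE.
by rewrite !expr0 mul1r mulr1 scale1r.
Qed.

Lemma is_torus_poly_nceval (f : ncpoly F) (phi : nat -> F -> F -> 'M[F]_N) :
  (forall k, is_torus_poly (phi k)) ->
  is_torus_poly (fun s t => nceval (fun k => phi k s t) f).
Proof.
move=> phiP; apply: is_torus_poly_sum => w; apply: is_torus_polyZ.
elim: (w : seq nat) => [|k u IHu].
  by have [l lE] := is_torus_poly1; exists l => s t; rewrite big_nil; exact: lE.
have [l lE] := is_torus_polyM (phiP k) IHu.
by exists l => s t; rewrite big_cons; exact: lE.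
Qed.

(** Orthogonality of the characters of Z/N, from the geometric sum. *)
Lemma sum_prim_expr (i j : 'I_N) :
  \sum_(k < N) (z ^+ i / z ^+ j) ^+ k = if i == j then N%:R else 0.
Proof.
have z0 : z != 0 by rewrite (prim_root_eq0 zP).
have zj0 : z ^+ j != 0 by rewrite expf_neq0.
case: eqP => [->|ij].
  rewrite divff // (eq_bigr (fun=> 1)) => [|k _]; last by rewrite expr1n.
  by rewrite sumr_const card_ord.
apply/eqP; have := subrX1 (z ^+ i / z ^+ j) N.
rewrite exprMn exprVn -!exprM ![(_ * N)%N]mulnC !exprM (prim_expr_order zP).
rewrite !expr1n invr1 mulr1 subrr => /esym/eqP; rewrite mulf_eq0 => /orP[|//].
rewrite subr_eq0 => /eqP e; case: ij; apply/val_inj/eqP.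
have: z ^+ i == z ^+ j by rewrite -[X in X == _](divfK zj0) e mul1r.
by rewrite (eq_prim_root_expr zP) !modn_small.
Qed.

(** By Fourier inversion on Z/N, the matrix unit E_ij is the average over k of z^(-ik) X^k Y^(j-i).
    Each monomial is then given its weight in s and t; s = t = 1 recovers [a]. *)
Definition torus_lift (a : 'M[F]_N) (s t : F) : 'M[F]_N :=
  \sum_(i < N) \sum_(j < N) \sum_(k < N) (a i j / N%:R / z ^+ (i * k)) *:
    ((s ^+ k * t ^+ (j - i)%R) *: (X ^+ k * Y ^+ (j - i)%R)).

Lemma is_torus_poly_lift a : is_torus_poly (torus_lift a).
Proof.
apply: is_torus_poly_sum => i; apply: is_torus_poly_sum => j.
apply: is_torus_poly_sum => k; apply: is_torus_polyZ.
exact: is_torus_poly_monomial.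
Qed.

Lemma torus_lift1 (charF0 : [pchar F] =i pred0) (a : 'M[F]_N) :
  torus_lift a 1 1 = a.
Proof.
pose c i j k := a i j / N%:R / z ^+ (i * k).
rewrite [RHS]matrix_sum_delta; apply: eq_bigr => i _; apply: eq_bigr => j _.
apply/matrixP => p q; rewrite summxE.
under eq_bigr => k _.
  rewrite !expr1n mul1r scale1r mxE -[X ^+ k * _]/(X ^+ k *m _) clock_mxX mul_diag_mx.
  rewrite mxE mxE shift_mxX natr_Zp.
  over.
rewrite !mxE.
have -> : \sum_(k < N) c i j k * (z ^+ (p * k) * (q == p + (j - i))%:R)
  = a i j / N%:R * (q == p + (j - i))%:R * \sum_(k < N) (z ^+ p / z ^+ i) ^+ k.
  rewrite mulr_sumr; apply: eq_bigr => k _.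
  rewrite /c exprMn exprVn -!exprM -!mulrA; congr (_ * (_ * _)).
  by rewrite mulrA mulrC [_^-1 * _]mulrC.
rewrite sum_prim_expr; have [->|_] := eqVneq p i; last by rewrite !mulr0.
rewrite (addrC i) subrK mulrAC divfK // natr_neq0 //.
Qed.

End QuantumTorus.

(** * Matrices of prime size *)

Lemma primitive_root_inv (F : fieldType) n (z : F) :
  n.-primitive_root z -> n.-primitive_root z^-1.
Proof.
move=> zP; have n0 := prim_order_gt0 zP.
have <- : z ^+ n.-1 = z^-1.
  apply: (mulIf (x := z)); first by rewrite (prim_root_eq0 zP) -lt0n.
  rewrite -exprSr prednK // (prim_expr_order zP) mulVf //.
  by rewrite (prim_root_eq0 zP) -lt0n.
rewrite (prim_root_exp_coprime _ zP); case: n n0 {zP} => // n _.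
exact: coprimenS.
Qed.

(** Commuting W = X^i Y^j past Y costs a factor z^i, and past X a factor z^(-j). For prime size, one
    of these is a primitive root unless both exponents are divisible by the size. *)
Lemma clock_shift_simple_spectrum (F : closedFieldType) n (z : F) i j :
    n.+2.-primitive_root z -> prime n.+2 ->
    ~~ ((n.+2 %| i) && (n.+2 %| j))%N ->
  simple_spectrum (clock_mx n z ^+ i * shift_mx F n ^+ j).
Proof.
move=> zP pr_n; have Xu := clock_unit zP; have Yu := shift_unit F n.
have Wu : clock_mx n z ^+ i * shift_mx F n ^+ j \in unitmx.
  by rewrite -[_ * _]/(_ *m _) unitmx_mul; apply/andP; split; exact: unitrX.
rewrite negb_and => /orP[]; rewrite -prime_coprime // coprime_sym => co.
  apply: (simple_spectrum_of_commute_root _ Wu Yu (z := z ^+ i)).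
    by rewrite prim_root_exp_coprime.
  have e1 := clock_shift_mul zP 0 1 i j; have e2 := clock_shift_mul zP i j 0 1.
  rewrite expr0 expr1 mul1n mul1r add0n add1n in e1.
  rewrite muln0 !expr0 expr1 mul1r scale1r addn0 addn1 in e2.
  by rewrite -[LHS]/(_ * _) e1 -e2.
apply: (simple_spectrum_of_commute_root _ Wu Xu (z := (z ^+ j)^-1)).
  by apply: primitive_root_inv; rewrite prim_root_exp_coprime.
have e1 := clock_shift_mul zP 1 0 i j; have e2 := clock_shift_mul zP i j 1 0.
rewrite mul0n !expr0 expr1 mulr1 scale1r add0n add1n in e1.
rewrite muln1 expr0 expr1 mulr1 addn0 addn1 in e2.
rewrite -[LHS]/(_ * _) e1 -[_ *m _]/(_ * _) e2 scalerA mulVf ?scale1r //.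
by rewrite expf_neq0 // (prim_root_eq0 zP).
Qed.

Lemma clock_shift_scalar (F : fieldType) n (z : F) i j :
    n.+2.-primitive_root z -> (n.+2 %| i)%N -> (n.+2 %| j)%N ->
  clock_mx n z ^+ i * shift_mx F n ^+ j = 1%:M.
Proof.
move=> zP /dvdnP[k ->] /dvdnP[l ->].
have -> : clock_mx n z ^+ (k * n.+2) = 1.
  apply/matrixP => p q; rewrite clock_mxX !mxE mulnA mulnC exprM.
  by rewrite (prim_expr_order zP) expr1n.
rewrite mul1r; apply/matrixP => p q; rewrite shift_mxX mxE eq_sym natrM.
by have /= -> := pchar_Zp (isT : 1 < n.+2)%N; rewrite mulr0 addr0.
Qed.

(* Off the centre, the term of a torus polynomial that dominates along
   s = u, t = u^K with K large and u generic is a single monomial. *)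
Lemma torus_poly_simple_spectrum (F : closedFieldType)
    (charF0 : [pchar F] =i pred0) n (z : F) (l : seq (F * nat * nat)) :
    n.+2.-primitive_root z -> prime n.+2 ->
    ~~ is_scalar_mx (torus_poly n z l 1 1) ->
  exists s t, simple_spectrum (torus_poly n z l s t).
Proof.
move=> zP pr_n; pose nc (q : F * nat * nat) := ~~ ((n.+2 %| q.1.2) && (n.+2 %| q.2))%N.
pose M (q : F * nat * nat) := clock_mx n z ^+ q.1.2 * shift_mx F n ^+ q.2.
(* The terms outside [nc] are scalar matrices, and adding a scalar keeps the eigenvalues
   distinct. *)
have splitE s t : torus_poly n z l s t =
    (\sum_(q <- l | ~~ nc q) q.1.1 * s ^+ q.1.2 * t ^+ q.2)%:M
    + \sum_(q <- l | nc q) (q.1.1 * s ^+ q.1.2 * t ^+ q.2) *: M q.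
  rewrite /torus_poly (bigID nc) /= addrC; congr (_ + _).
  rewrite raddf_sum; apply: eq_bigr => q /negPn/andP[q1 q2].
  by rewrite clock_shift_scalar // -[RHS]scalemx1.
(* Clock exponents in [l] are below [K], so the weight i + K j, which is the degree in u at s = u, t
   = u^K, determines (i, j). Hence [P e] is a multiple of a single monomial. *)
pose K := (\sum_(q <- l) q.1.2).+1.
have ltK q : q \in l -> (q.1.2 < K)%N.
  by move=> ql; rewrite ltnS (big_rem q) //= leq_addr.
pose w (r : F * nat * nat) := (r.1.2 + K * r.2)%N.
pose B := \sum_(q <- l) w q.
have leB q : q \in l -> (w q <= B)%N.
  by move=> ql; rewrite /B (big_rem q) //= leq_addr.
pose P e := \sum_(q <- l | nc q && (w q == e)) q.1.1 *: M q.
have sumE u : \sum_(q <- l | nc q) (q.1.1 * u ^+ q.1.2 * (u ^+ K) ^+ q.2) *: M q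
    = \sum_(e < B.+1) u ^+ e *: P e.
  transitivity (\sum_(q <- l | nc q) \sum_(e < B.+1 | w q == e) u ^+ e *: (q.1.1 *: M q)).
    rewrite big_seq_cond [RHS]big_seq_cond; apply: eq_bigr => q /andP[ql _].
    have wB : (w q < B.+1)%N by rewrite ltnS leB.
    rewrite (big_pred1 (Ordinal wB)) => [|e]; last by rewrite /= eq_sym.
    by rewrite /= scalerA; congr (_ *: _); rewrite /w exprD exprM; ring.
  rewrite (exchange_big_dep predT) //=; apply: eq_bigr => e _.
  by rewrite /P scaler_sumr.
have PE e : P e != 0 -> simple_spectrum (P e).
  move=> Pe0; have modw q : q \in l -> w q = e -> q.1.2 = (e %% K)%N /\ q.2 = (e %/ K)%N.
    move=> /ltK qK <-; rewrite /w addnC mulnC modnMDl modn_small //.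
    by rewrite divnMDl // divn_small // addn0.
  pose W := clock_mx n z ^+ (e %% K) * shift_mx F n ^+ (e %/ K).
  have PeE : P e = (\sum_(q <- l | nc q && (w q == e)) q.1.1) *: W.
    rewrite scaler_suml /P big_seq_cond [RHS]big_seq_cond.
    apply: eq_bigr => q /and3P[ql _ /eqP /(modw _ ql)[e1 e2]].
    by rewrite /M e1 e2.
  have [/hasP[q ql /andP[ncq /eqP/(modw _ ql)[e1 e2]]]|nohas] :=
    boolP (has (fun q => nc q && (w q == e)) l); last first.
    by rewrite /P big_hasC ?eqxx in Pe0.
  rewrite PeE -[_ *: _]add0r -(raddf0 (@scalar_mx F n.+2)).
  apply: simple_spectrum_shift_scale.
    by apply: contraNneq Pe0; rewrite PeE => ->; rewrite scale0r.
  by apply: clock_shift_simple_spectrum => //; rewrite -e1 -e2.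
(* If all [P e] vanished, the value at s = t = 1 would be scalar. *)
move=> ns1; have exP : exists e, (e < B.+1)%N && (P e != 0).
  have [/existsP[e Pe]|/existsPn P0] := boolP [exists e : 'I_B.+1, P e != 0].
    by exists e; rewrite ltn_ord.
  case/negP: ns1; have s1 := sumE 1; rewrite expr1n in s1.
  rewrite [X in _ = X]big1 in s1 => [|e _]; last first.
    by have /negPn/eqP -> := P0 e; rewrite scaler0.
  by rewrite splitE s1 addr0 scalar_mx_is_scalar.
have leP e : (e < B.+1)%N && (P e != 0) -> (e <= B)%N by case/andP.
(* For the largest [e] with [P e] nonzero, the sum up to [e] is the whole noncentral part. *)
case: (ex_maxnP exP leP) => e /andP[eB /PE/(simple_spectrum_dominant charF0)].
move=> [u u0 Pu] emax; exists u, (u ^+ K); rewrite splitE sumE.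
rewrite -[X in _ + X]scale1r; apply: simple_spectrum_shift_scale.
  exact: oner_neq0.
rewrite (big_ord_widen _ (fun e => u ^+ e *: P e) eB) big_mkcond /= in Pu.
congr simple_spectrum: Pu; apply: eq_bigr => k _; case: ltnP => // ek.
have [->|Pk] := eqVneq (P k) 0; first by rewrite scaler0.
by have := emax k; rewrite ltn_ord Pk leqNgt ek => /(_ isT).
Qed.

Lemma prime_image_simple_spectrum (F : closedFieldType)
    (charF0 : [pchar F] =i pred0) n (f : ncpoly F) (a : nat -> 'M[F]_n.+2) :
    prime n.+2 -> ~~ is_scalar_mx (nceval a f) ->
  exists2 D : 'M[F]_n.+2, simple_spectrum D & ncimage f D.
Proof.
move=> pr_n; have [z zP] := primitive_root_exists charF0 n.+1.
have [l lE] := is_torus_poly_nceval zP f (fun k => is_torus_poly_lift z (a k)).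
have <- : nceval (fun k => torus_lift z (a k) 1 1) f = nceval a f.
  rewrite /nceval; apply: eq_bigr => w _; congr (_ *: _).
  by apply: eq_bigr => k _; rewrite torus_lift1.
rewrite lE => /(torus_poly_simple_spectrum charF0 zP pr_n)[s [t]].
by rewrite -lE => sp; eexists; [exact: sp | eexists].
Qed.

(** * Evaluation of multilinear polynomials, and the cyclic grading of matrices *)

(** Rewriting [nceval], a sum over the support, as [mmap] gives additivity, so each monomial can be
    evaluated separately. *)
Lemma nceval_multilinear (F : fieldType) (A : algType F) m (c : 'S_m -> F)
    (a : nat -> A) :
  nceval a (\sum_(s : 'S_m) c s *: \prod_(i < m) ncvar F (s i))
  = \sum_(s : 'S_m) c s *: \prod_(i < m) a (s i).
Proof.
pose h (w : {fmonom nat}) := \prod_(i <- (w : seq nat)) a i.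
have ncevalE f : nceval a f = mmap (in_alg A) h f.
  by apply: eq_bigr => w _; rewrite mulr_algl.
have monoE (e : F) (r : seq 'I_m) (s : 'S_m) :
    e *: \prod_(i <- r) ncvar F (s i)
    = << e *g FMonom [seq (s i : nat) | i <- r] >>.
  have -> : \prod_(i <- r) ncvar F (s i) = << FMonom [seq (s i : nat) | i <- r] >>.
    elim: r => [|i r IHr]; first by rewrite big_nil /= -fmoneE.
    rewrite big_cons IHr malgM_def fgmulUU mulr1; congr << _ >>.
    by apply/eqP; rewrite fmP fmM fmU.
  by apply/malgP => k; rewrite mcoeffZ !mcoeffU mulrnAr mulr1.
rewrite ncevalE raddf_sum; apply: eq_bigr => s _ /=.
rewrite monoE mmapU /= mulr_algl; congr (_ *: _).
by rewrite /h /= big_map.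
Qed.

Section Graded.

Variables (F : fieldType) (n : nat).
Local Notation N := n.+2.
Implicit Types (A B : 'M[F]_N) (d : 'I_N).

(** The entry (i, j) has degree j - i in Z/N; the zero matrix is homogeneous of every degree. *)
Definition homogeneous d A : Prop := forall i j, A i j != 0 -> j = i + d.

Definition homog_part d A : 'M[F]_N := \matrix_(i, j) (A i j *+ (j == i + d)).

(** This is conjugation by a cyclic permutation matrix, an algebra automorphism that preserves
    degrees. *)
Definition rot_mx d A : 'M[F]_N := \matrix_(i, j) A (i + d) (j + d).

Lemma homog_partP d A : homogeneous d (homog_part d A).
Proof.
move=> i j; have [//|ji] := eqVneq j (i + d).
by rewrite mxE (negPf ji) eqxx.
Qed.

Lemma sum_homog_part A : \sum_d homog_part d A = A.
Proof.
apply/matrixP => i j; rewrite summxE (bigD1 (j - i)) //= big1 => [|d di].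
  by rewrite mxE (addrC i) subrK eqxx addr0.
by rewrite mxE (addrC i) -subr_eq eq_sym (negPf di).
Qed.

Lemma homogeneousD d A B :
  homogeneous d A -> homogeneous d B -> homogeneous d (A + B).
Proof.
move=> hA hB i j; rewrite mxE; have [A0|/hA //] := eqVneq (A i j) 0.
by rewrite A0 add0r => /hB.
Qed.

Lemma homogeneousZ d c A : homogeneous d A -> homogeneous d (c *: A).
Proof. by move=> hA i j; rewrite mxE mulf_eq0 negb_or => /andP[_ /hA]. Qed.

Lemma homogeneous0 d : homogeneous d 0.
Proof. by move=> i j; rewrite mxE eqxx. Qed.

Lemma homogeneous1 : homogeneous 0 1.
Proof.
by move=> i j; have [->|ij] := eqVneq i j; rewrite ?addr0 // mxE (negPf ij) eqxx.
Qed.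

Lemma homogeneousM d e A B :
  homogeneous d A -> homogeneous e B -> homogeneous (d + e) (A * B).
Proof.
move=> hA hB i j; have [-> //|ij] := eqVneq j (i + (d + e)).
rewrite -[A * B]/(A *m B) mxE big1 ?eqxx // => k _.
have [->|/hA kE] := eqVneq (A i k) 0; first by rewrite mul0r.
have [->|/hB jE] := eqVneq (B k j) 0; first by rewrite mulr0.
by case/eqP: ij; rewrite jE kE addrA.
Qed.

Lemma homogeneous_prod (I : Type) (r : seq I) (d : I -> 'I_N) (A : I -> 'M[F]_N) :
  (forall i, homogeneous (d i) (A i)) ->
  homogeneous (\sum_(i <- r) d i) (\prod_(i <- r) A i).
Proof.
move=> hA; elim: r => [|i r IHr]; first by rewrite !big_nil; exact: homogeneous1.
by rewrite !big_cons; exact: homogeneousM.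
Qed.

Lemma homogeneous_rot d e A : homogeneous d A -> homogeneous d (rot_mx e A).
Proof.
by move=> hA i j; rewrite mxE => /hA; rewrite addrAC => /addIr.
Qed.

Lemma rot_mxM d A B : rot_mx d (A * B) = rot_mx d A * rot_mx d B.
Proof.
apply/matrixP => i j; rewrite -[A * B]/(A *m B) -[RHS]/((_ *m _) i j) !mxE.
rewrite (reindex_inj (addIr d)) /=; apply: eq_bigr => k _.
by rewrite !mxE.
Qed.

Lemma rot_mx_prod (I : Type) (r : seq I) d (A : I -> 'M[F]_N) :
  rot_mx d (\prod_(i <- r) A i) = \prod_(i <- r) rot_mx d (A i).
Proof.
elim: r => [|i r IHr].
  by rewrite !big_nil; apply/matrixP => i j; rewrite !mxE (inj_eq (addIr d)).
by rewrite !big_cons rot_mxM IHr.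
Qed.

Lemma rot_mx_sum (I : finType) d (c : I -> F) (A : I -> 'M[F]_N) :
  rot_mx d (\sum_i c i *: A i) = \sum_i c i *: rot_mx d (A i).
Proof.
apply/matrixP => i j; rewrite mxE !summxE.
by apply: eq_bigr => k _; rewrite !mxE.
Qed.

End Graded.

(** Such a matrix is an invertible diagonal matrix times the shift, so it commutes with the clock
    matrix up to a primitive root. *)
Lemma homogeneous1_simple_spectrum (F : closedFieldType)
    (charF0 : [pchar F] =i pred0) n (C : 'M[F]_n.+2) :
  homogeneous 1 C -> (forall i, C i (i + 1) != 0) -> simple_spectrum C.
Proof.
move=> hC C0; have [z zP] := primitive_root_exists charF0 n.+1.
pose D := diag_mx (\row_i C i (i + 1)).
have CE : C = D *m shift_mx F n.
  apply/matrixP => i j; rewrite mul_diag_mx !mxE.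
  case: eqP => [->|ij]; first by rewrite mulr1.
  by rewrite mulr0; apply/eqP; apply: contraT => /hC.
have Xu := clock_unit zP.
have Cu : C \in unitmx.
  rewrite CE unitmx_mul; apply/andP; split; last exact: shift_unit.
  by rewrite unitmxE det_diag unitfE; apply/prodf_neq0 => i _; rewrite mxE.
have CX : C *m clock_mx n z = z *: (clock_mx n z *m C).
  rewrite CE -mulmxA -[shift_mx F n *m _]/(_ * _) (shift_clock zP) -scalemxAr.
  by rewrite !mulmxA diag_mxC.
apply: (simple_spectrum_of_commute_root (primitive_root_inv zP) Cu Xu).
by rewrite CX scalerA mulVf ?scale1r // (prim_root_eq0 zP).
Qed.

(** * Multilinear polynomials at generic homogeneous arguments *)

(** Induction on [r]: on the line joining a point good for the earlier functions to one good for the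
    new function, the product of all the restrictions is a nonzero polynomial. *)
Lemma common_nonroot (F : closedFieldType) (V : lmodType F) (Q : V -> Prop)
    (I : eqType) (c : I -> V -> F) (p : I -> V -> V -> {poly F}) (r : seq I) :
    (forall x y w, Q x -> Q y -> Q (x + w *: (y - x))) ->
    (forall i x y w, (p i x y).[w] = c i (x + w *: (y - x))) ->
    (exists x, Q x) ->
    (forall i, i \in r -> exists2 x, Q x & c i x != 0) ->
  exists2 x, Q x & forall i, i \in r -> c i x != 0.
Proof.
move=> Qline pE [x0 Qx0]; elim: r => [|i r IHr] hr; first by exists x0.
have [|x Qx xr] := IHr; first by move=> j jr; apply: hr; rewrite inE jr orbT.
have [y Qy yi] := hr i (mem_head _ _).
have : \prod_(j <- i :: r) p j x y != 0.
  (* The new factor is nonzero at w = 1, that is at [y], the others at w = 0, that is at [x]. *)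
  rewrite prodf_seq_neq0; apply/allP => j; rewrite inE /= => /predU1P[->|/xr].
    apply: contraNneq yi => p0; rewrite -(subrK x y) addrC -[y - x]scale1r.
    by rewrite -pE p0 horner0.
  apply: contraNneq => p0; rewrite -[x]addr0 -[X in x + X](scale0r (y - x)).
  by rewrite -pE p0 horner0.
move=> /closed_nonrootP[w]; rewrite rootE horner_prod prodf_seq_neq0 => /allP pw.
exists (x + w *: (y - x)); first exact: Qline.
by move=> j /pw; rewrite -pE.
Qed.

Section MultilinearEval.

Variables (F : closedFieldType) (n m : nat) (c : 'S_m -> F).
Local Notation M := 'M[F]_n.+2.
Local Notation args := {ffun 'I_m -> 'M[F]_n.+2}.

(** Arguments are finite functions so that they form a vector space, as [common_nonroot]
    requires. *)
Definition ml_eval (b : args) : M := \sum_(s : 'S_m) c s *: \prod_(i < m) b (s i).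

(** Every monomial uses each argument exactly once, so all monomials have the same degree. *)
Lemma ml_eval_homogeneous (d : 'I_m -> 'I_n.+2) (b : args) :
  (forall k, homogeneous (d k) (b k)) ->
  homogeneous (\sum_k d k) (ml_eval b).
Proof.
move=> hb; apply: (big_ind (homogeneous (\sum_k d k))) => [|A B|s _].
- exact: homogeneous0.
- exact: homogeneousD.
apply: homogeneousZ; rewrite (reindex_inj (@perm_inj _ s)) /=.
by apply: homogeneous_prod => i.
Qed.

Lemma ml_eval_rot d (b : args) :
  ml_eval [ffun k => rot_mx d (b k)] = rot_mx d (ml_eval b).
Proof.
rewrite rot_mx_sum; apply: eq_bigr => s _; congr (_ *: _).
by rewrite rot_mx_prod; apply: eq_bigr => i _; rewrite ffunE.
Qed.

Lemma ml_eval_sum_homog_part (b : args) :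
  ml_eval b = \sum_(d : {ffun 'I_m -> 'I_n.+2})
    ml_eval [ffun k => homog_part (d k) (b k)].
Proof.
rewrite exchange_big /=; apply: eq_bigr => s _; rewrite -scaler_sumr.
congr (_ *: _).
transitivity (\prod_(i < m) \sum_d homog_part d (b (s i))).
  by apply: eq_bigr => i _; rewrite sum_homog_part.
rewrite bigA_distr_bigA /=.
(* Expanding the product attaches degrees to positions; [h] moves them to the variables, so that the
   same [d] serves for all permutations. *)
pose h (d : {ffun 'I_m -> 'I_n.+2}) : {ffun 'I_m -> 'I_n.+2} := [ffun i => d (s i)].
have h_inj : injective h.
  move=> d e /ffunP de; apply/ffunP => i.
  by have := de (s^-1%g i); rewrite !ffunE permKV.
rewrite (reindex_inj h_inj) /=; apply: eq_bigr => d _.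
by apply: eq_bigr => i _; rewrite !ffunE.
Qed.

Definition ml_eval_line (b e : args) : 'M[{poly F}]_n.+2 :=
  \sum_(s : 'S_m) (c s)%:P *: \prod_(i < m)
    (map_mx polyC (b (s i)) + 'X *: map_mx polyC ((e - b) (s i))).

Lemma ml_eval_lineE b e w :
  map_mx (horner_eval w) (ml_eval_line b e) = ml_eval (b + w *: (e - b)).
Proof.
rewrite rmorph_sum; apply: eq_bigr => s _ /=.
rewrite map_mxZ /= /horner_eval hornerC; congr (_ *: _).
rewrite (rmorph_prod (map_mx (horner_eval w))); apply: eq_bigr => i _.
apply/matrixP => p q; rewrite !ffunE !mxE /= /horner_eval.
by rewrite hornerD hornerM hornerX !hornerC.
Qed.

Lemma ml_eval_simple_spectrum (charF0 : [pchar F] =i pred0) (b : args) :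
  ml_eval b 0 1 != 0 -> exists b' : args, simple_spectrum (ml_eval b').
Proof.
rewrite ml_eval_sum_homog_part summxE => /eqP sum_n0.
have [d d01] : exists d : {ffun 'I_m -> 'I_n.+2},
    ml_eval [ffun k => homog_part (d k) (b k)] 0 1 != 0.
  apply/existsP; apply/contra_notT: sum_n0 => /existsPn all0.
  by rewrite big1 // => d _; have /negPn/eqP := all0 d.
set b1 := [ffun k => _] in d01.
pose Q (x : args) := forall k, homogeneous (d k) (x k).
have Qb1 : Q b1 by move=> k; rewrite ffunE; exact: homog_partP.
(* The nonzero entry (0, 1) forces the total degree to be 1. *)
have d1 : \sum_k d k = 1.
  by have /(_ 0 1 d01) := ml_eval_homogeneous Qb1; rewrite add0r.
have [] := @common_nonroot F args Q 'I_n.+2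
    (fun i x => ml_eval x i (i + 1)) (fun i x y => ml_eval_line x y i (i + 1))
    (enum 'I_n.+2).
- move=> x y w Qx Qy k; rewrite !ffunE; apply: homogeneousD => //.
  apply: homogeneousZ; apply: homogeneousD => //.
  by rewrite -scaleN1r; apply: homogeneousZ.
- by move=> i x y w; rewrite -ml_eval_lineE mxE.
- by exists b1.
(* Rotation by -i carries the entry (0, 1) to (i, i+1). *)
- move=> i _; exists [ffun k => rot_mx (- i) (b1 k)].
    by move=> k; rewrite ffunE; apply: homogeneous_rot.
  by rewrite ml_eval_rot mxE subrr addrAC subrr add0r.
move=> x Qx x0; exists x; apply: homogeneous1_simple_spectrum => // [|i].
  by rewrite -d1; apply: ml_eval_homogeneous.
by apply: x0; rewrite mem_enum.
Qed.

End MultilinearEval.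

Lemma multilinear_image_simple_spectrum (F : closedFieldType)
    (charF0 : [pchar F] =i pred0) n (f : ncpoly F) (a : nat -> 'M[F]_n.+2) :
    multilinear f -> ~~ is_scalar_mx (nceval a f) ->
  exists2 D : 'M[F]_n.+2, simple_spectrum D & ncimage f D.
Proof.
move=> [m [c ->]] /(@nonscalar_conj_row0 F n)[g gu].
rewrite -nceval_conj // nceval_multilinear => /rowP/(_ 1).
pose b : {ffun 'I_m -> 'M[F]_n.+2} := [ffun k : 'I_m => g *m a k *m invmx g].
have -> : \sum_(s : 'S_m) c s *: \prod_(i < m) (g *m a (s i) *m invmx g)
    = ml_eval c b.
  apply: eq_bigr => s _; congr (_ *: _).
  by apply: eq_bigr => i _; rewrite ffunE.
rewrite mxE [RHS]mxE !eqxx /= => b01.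
have [|b' sb'] := @ml_eval_simple_spectrum F n m c charF0 b.
  by rewrite b01 oner_neq0.
exists (ml_eval c b') => //.
(* Variables from index m on do not occur in the polynomial and receive the value 0. *)
exists (fun k => if insub k is Some i then b' i else 0).
rewrite nceval_multilinear; apply: eq_bigr => s _; congr (_ *: _).
by apply: eq_bigr => i _; rewrite valK.
Qed.

Theorem theorem4p1 (F : closedFieldType) (charF0 : [pchar F] =i pred0)
    (n : nat) (f : ncpoly F)
    (f_not_identity : ~ poly_identity f 'M[F]_n.+1)
    (f_not_central : ~ central_polynomial f 'M[F]_n.+1)
    (prime_or_multilinear : prime n.+1 \/ multilinear f)
    (T : 'M[F]_n.+1) (trT0 : \tr T = 0) :
  ncimage_diff f T.
Proof.
(* If all values were scalar, [f] would be central, since it is not an identity. *)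
have [a ns] : exists a : nat -> 'M[F]_n.+1, ~~ is_scalar_mx (nceval a f).
  apply: NNPP => all_scalar; apply: f_not_central; split=> // b [a ->].
  have [/is_scalar_mxP[x ->]|ns] := boolP (is_scalar_mx (nceval a f)).
    by move=> M; exact/esym/(scalar_mxC x M).
  by case: all_scalar; exists a.
(* Matrices of size 1 are scalar, so the size is at least 2. *)
case: n T trT0 a ns prime_or_multilinear {f_not_identity f_not_central}
    => [|n] T trT0 a ns pr_or_ml.
  by case/negP: ns; rewrite [nceval a f]mx11_scalar scalar_mx_is_scalar.
have [D spD fD] : exists2 D : 'M[F]_n.+2, simple_spectrum D & ncimage f D.
  case: pr_or_ml => [pr_n|ml_f]; first exact: prime_image_simple_spectrum ns.
  exact: multilinear_image_simple_spectrum ns.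
have [|A [B [fA fB TE]]] :=
    @trace0_sub_of_simple_spectrum F charF0 _ (fun A => ncimage f A) D T _ spD fD trT0.
  by move=> g A gu; exact: ncimage_conj.
by exists A, B.
Qed.
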